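(* Let $K$ be a field, let $I_1\subset R_1=K[\mathbf{x}]$ and $I_2\subset R_2=K[\mathbf{y}]$ be two (proper) monomial ideals in polynomial rings on disjoint finite sets of variables $\mathbf{x}$ and $\mathbf{y}$, and let $R=K[\mathbf{x},\mathbf{y}]$. Then $$\mathrm{v}(I_1R+I_2R)=\mathrm{v}(I_1)+\mathrm{v}(I_2).$$
   Context: Polynomial rings over $K$ have the standard grading, and $R_d$ denotes the degree-$d$ homogeneous component of a polynomial ring $R$. For a proper graded ideal $I$ of a polynomial ring $R$, its v-number is $\mathrm{v}(I)=\min\{d\ge 0 : \exists f\in R_d \text{ and } \mathfrak{p}\in\mathrm{Ass}(R/I)\text{ with } (I:f)=\mathfrak{p}\}$. The numbers $\mathrm{v}(I_1)$ and $\mathrm{v}(I_2)$ are computed in $K[\mathbf{x}]$ and $K[\mathbf{y}]$ respectively. *)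

(* Defs.v *)
From Stdlib Require Import ClassicalEpsilon.
From HB Require Import structures.
From mathcomp Require Import all_boot all_order all_algebra.
From mathcomp Require Import mpoly.

Set Implicit Arguments.
Unset Strict Implicit.
Unset Printing Implicit Defensive.

Import GRing.Theory.
Local Open Scope ring_scope.

(* Ideals are [Prop]-valued predicates: membership need not be decidable, so
   the boolean ideals of [ring_quotient] would be too restrictive. *)

Section Ideals.
Variable R : comNzRingType.
Implicit Types (A B I J P : R -> Prop) (f : R).

Definition set_eq A B : Prop := forall g, A g <-> B g.

Definition is_ideal I : Prop :=
  [/\ I 0, forall g h, I g -> I h -> I (g + h) & forall a g, I g -> I (a * g)].

Definition is_proper I : Prop := ~ I 1.

Definition is_prime P : Prop :=
  [/\ is_ideal P, is_proper P & forall g h, P (g * h) -> P g \/ P h].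

Definition ideal_gen A : R -> Prop :=
  fun g => forall J, is_ideal J -> (forall h, A h -> J h) -> J g.

Definition ideal_add I J : R -> Prop :=
  fun g => exists a b, [/\ I a, J b & g = a + b].

Definition colon I f : R -> Prop := fun g => I (g * f).

(* [colon I g] is the annihilator of the class of [g] in R/I. *)
Definition in_Ass I P : Prop := is_prime P /\ exists g, set_eq P (colon I g).

End Ideals.

Definition ideal_ext (R S : comNzRingType) (phi : R -> S) (I : R -> Prop) :
    S -> Prop :=
  ideal_gen (fun q => exists2 p, I p & q = phi p).

Definition is_least (D : nat -> Prop) (d : nat) : Prop :=
  D d /\ forall d', D d' -> (d <= d')%N.

Lemma is_least_uniq (D : nat -> Prop) d d' :
  is_least D d -> is_least D d' -> d = d'.
Proof.
move=> [Dd led] [Dd' led']; apply/eqP.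
by rewrite eqn_leq led // led'.
Qed.

Section PolynomialIdeals.
Variables (K : fieldType) (n : nat).
Implicit Types (I : {mpoly K[n]} -> Prop).

Definition is_monomial_ideal I : Prop :=
  exists S : 'X_{1..n} -> Prop,
    set_eq I (ideal_gen (fun g => exists2 m, S m & g = 'X_[m])).

Definition vdegree I (d : nat) : Prop :=
  exists f P, [/\ f \is d.-homog, in_Ass I P & set_eq (colon I f) P].

(* The minimum of [vdegree I]; unspecified if no such degree exists. *)
Definition vnumber I : nat := epsilon (inhabits 0%N) (is_least (vdegree I)).

Lemma vnumberE I d : is_least (vdegree I) d -> vnumber I = d.
Proof.
move=> Id; apply: is_least_uniq (Id).
by apply: (epsilon_spec (inhabits 0%N)); exists d.
Qed.

End PolynomialIdeals.

(* K[x,y] is [{mpoly K[n + m]}]: the first [n] variables are the x's and the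
   last [m] are the y's. *)
Definition incl_x (K : fieldType) (n m : nat) (p : {mpoly K[n]}) :
    {mpoly K[n + m]} :=
  comp_mpoly [tuple 'X_(lshift m i) | i < n] p.

Definition incl_y (K : fieldType) (n m : nat) (p : {mpoly K[m]}) :
    {mpoly K[n + m]} :=
  comp_mpoly [tuple 'X_(rshift n i) | i < m] p.

(* Main.v *)
Require Import Defs.
From Stdlib Require Import Classical.
From mathcomp Require Import all_boot all_order all_algebra.
From mathcomp Require Import mpoly.
From mathcomp Require Import zify ring.

Set Implicit Arguments.
Unset Strict Implicit.
Unset Printing Implicit Defensive.

Import GRing.Theory.
Local Open Scope ring_scope.

(** A monomial ideal [I] is recorded by the up-closed set [U] of the exponents
of its monomials ([monomial_idealE]): a polynomial is in [I] if and only if all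
its exponents are in [U]. The colon of [I] by ['X_[a]] is again monomial, with
set of exponents [shift U a].

The point is that the v-number is attained by a monomial. Let [(I : f) = P] be
prime with [f] homogeneous of degree [d], and let [V] be the set of the [u] with
['X_[u]] in [P]. As [I] is monomial, [V] is the intersection of the sets
[shift U a] for [a] in the support of [f]. A prime set that contains a finite
intersection of up-closed sets contains one of them ([prime_set_inter]), so
[V = shift U a] for some [a] in the support of [f], and [a] has degree [d]
([monomial_witness]). Conversely, a monomial ideal is prime as soon as it is
prime on monomials, by comparison of leading monomials ([mono_ideal_prime]).
Hence [vnumber I] is the least degree of an [a] for which [shift U a] is a prime
set ([vdegree_monomial]).

In these terms the sum formula is immediate. The exponents of [I1 R + I2 R] are
the pairs [(a, b)] with [a] in [U1] or [b] in [U2]; the shift of this set by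
[(a, b)] is prime if and only if both [shift U1 a] and [shift U2 b] are
([prime_shift_join]); degrees add, and the two minima are independent.

The minimum must also be over a nonempty set of degrees: a proper up-closed set
has a prime shift ([prime_shift_exists]). In place of the ascending chain
condition on ideals, the proof maximizes twice: first the number of variables
whose powers can be multiplied in without ever entering the ideal, then the
exponents of the remaining variables. *)

Lemma least_exists (D : nat -> Prop) :
  (exists d, D d) -> exists d, is_least D d.
Proof.
move=> [d Dd]; elim/ltn_ind: d Dd => d IHd Dd.
case: (classic (exists2 e, (e < d)%N & D e)) => [[e lt_ed De]|noe].
  exact: IHd lt_ed De.
exists d; split=> // e De; rewrite leqNgt; apply/negP => lt_ed.
by apply: noe; exists e.
Qed.

Lemma greatest_exists (D : nat -> Prop) (B : nat) :
    (exists d, D d) -> (forall d, D d -> (d <= B)%N) ->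
  exists2 d, D d & forall e, D e -> (e <= d)%N.
Proof.
move=> [d0 Dd0] leB.
have [|d [[d' Dd' ->] mind]] :=
  @least_exists (fun k => exists2 d, D d & k = (B - d)%N).
  by exists (B - d0)%N, d0.
exists d' => // e De; have := mind _ (ex_intro2 _ _ e De erefl).
by have := leB _ De; have := leB _ Dd'; lia.
Qed.

(** * Up-closed sets of exponents *)

Section UpClosed.
Variable n : nat.
Implicit Types (U V : 'X_{1..n} -> Prop) (a b c u v : 'X_{1..n}).

Definition up_closed U := forall u v, U u -> U (u + v)%MM.

Definition prime_set V :=
  ~ V 0%MM /\ forall u v, V (u + v)%MM -> V u \/ V v.

Definition shift U a := fun u => U (u + a)%MM.

Lemma up_closed_le U u v : up_closed U -> (u <= v)%MM -> U u -> U v.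
Proof. by move=> upU /submK <- Uu; rewrite addmC; apply: upU. Qed.

Lemma up_closed_shift U a : up_closed U -> up_closed (shift U a).
Proof.
rewrite /shift => upU u v Uu; apply: up_closed_le Uu => //.
by apply/mnm_lepP => i; rewrite !mnmDE; lia.
Qed.

(** This is the set-of-exponents form of the fact that a prime ideal containing
a finite intersection of ideals contains one of them: the complement of [V] is
closed under addition, so witnesses against the single inclusions could be
added up to a witness against the inclusion of the intersection. *)
Lemma prime_set_inter V (I : eqType) (r : seq I) (W : I -> 'X_{1..n} -> Prop) :
    prime_set V -> (forall i, up_closed (W i)) ->
    (forall u, (forall i, i \in r -> W i u) -> V u) ->
  exists2 i, i \in r & forall u, W i u -> V u.
Proof.
move=> [V0 VD] upW; elim: r => [|i r IHr] WV; first by case: V0; apply: WV.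
case: (classic (exists2 x, W i x & ~ V x)) => [[x Wx Vx]|none].
  case: IHr => [u Wu|j rj WjV]; last by exists j; rewrite // inE rj orbT.
  have /VD[] // : V (x + u)%MM.
  apply: WV => j; rewrite inE => /orP[/eqP->|/Wu Wju]; first exact: upW.
  by rewrite addmC; apply: upW.
exists i; first exact: mem_head.
by move=> u Wu; apply: NNPP => Vu; apply: none; exists u.
Qed.

(** Such a [V] is the set of exponents of the ideal generated by the variables
outside [T]. *)
Lemma prime_set_coordinates V (T : {set 'I_n}) :
  (forall u, V u <-> exists2 i, i \notin T & u i != 0%N) -> prime_set V.
Proof.
move=> VE; split=> [/VE[i _]|u v /VE[i Ti]]; first by rewrite mnm0E.
rewrite mnmDE addn_eq0 negb_and => /orP[ui|vi]; [left|right].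
  by apply/VE; exists i.
by apply/VE; exists i.
Qed.

Definition supported (T : {set 'I_n}) u := forall i, i \notin T -> u i = 0%N.

(** Equivalently, the monomials in the variables of [T] act on the class of
['X_[a]] modulo the ideal of [U] without killing it. *)
Definition free U (T : {set 'I_n}) a :=
  forall u, supported T u -> ~ U (u + a)%MM.

Lemma supported0 T : supported T 0%MM.
Proof. by move=> i _; rewrite mnm0E. Qed.

Lemma max_free_set U : ~ U 0%MM ->
  exists T a, free U T a /\
    forall i b, i \notin T -> ~ free U (i |: T) b.
Proof.
move=> U0.
have [||k [T [a [kE fTa]]] maxk] :=
  @greatest_exists
    (fun k => exists (T : {set 'I_n}) a, k = #|T| /\ free U T a) n.
- exists 0%N, set0, 0%MM; split; first by rewrite cards0.
  move=> u u0; suff ->: u = 0%MM by rewrite addm0.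
  by apply/mnmP => i; rewrite mnm0E u0 ?inE.
- by move=> d [T [a [-> _]]]; rewrite -[leqRHS]card_ord max_card.
exists T, a; split=> // i b Ti fTib.
have := maxk _ (ex_intro _ _ (ex_intro _ _ (conj erefl fTib))).
by rewrite kE cardsU1 Ti add1n ltnn.
Qed.

Lemma unfreeP U T a : ~ free U T a -> exists2 u, supported T u & U (u + a)%MM.
Proof.
move=> nf; apply: NNPP => nex; apply: nf => u Tu Uu; apply: nex.
by exists u.
Qed.

(** Take [c] above [a], free for [T], with the largest total exponent off [T].
Such a [c] exists because the exponents off [T] are bounded: [i |: T] is not
free at [a], so some [w i] with support in [i |: T] brings [a] into [U]; if
[c i] reached [w i i + a i], then the [T]-part of [w i] would bring [c] into
[U]. *)
Lemma saturated_translate U T a : up_closed U ->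
    free U T a -> (forall i b, i \notin T -> ~ free U (i |: T) b) ->
  exists2 c, free U T c & forall i, i \notin T -> ~ free U T (c + U_(i))%MM.
Proof.
move=> upU fTa maxT.
have /fin_all_exists[w wP] : forall i, exists w,
    i \notin T -> supported (i |: T) w /\ U (w + a)%MM.
  move=> i; case: (boolP (i \in T)) => [_|Ti]; first by exists 0%MM.
  by have [w sw Uw] := unfreeP (maxT i a Ti); exists w.
pose weight c := (\sum_(i | i \notin T) c i)%N.
have [||k [c [kE lac fTc]] maxk] := @greatest_exists
    (fun k => exists c, [/\ k = weight c, (a <= c)%MM & free U T c])
    (\sum_(i | i \notin T) (w i i + a i))%N.
- by exists (weight a), a; split=> //; apply: lepm_refl.
- move=> d [c [-> lac fTc]]; apply: leq_sum => i Ti.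
  rewrite leqNgt; apply/negP => /ltnW lt_c.
  have [sw Uw] := wP i Ti.
  (* The part of [w i] in the variables of [T]. *)
  pose w' := [multinom if j == i then 0%N else w i j | j < n].
  apply: (fTc w').
    move=> j Tj; rewrite mnmE; case: eqP => // /eqP ji.
    by apply: sw; rewrite !inE negb_or ji.
  apply: up_closed_le Uw => //; apply/mnm_lepP => j.
  rewrite !mnmDE mnmE; case: eqP => [->|_]; first by rewrite add0n.
  by rewrite leq_add2l; apply/mnm_lepP.
exists c => // i Ti fTci.
have lac' : (a <= c + U_(i))%MM by apply: lepm_trans lac (lem_addr _ _).
have := maxk _ (ex_intro _ _ (And3 erefl lac' fTci)).
(* [c + U_(i)] would be a competitor whose weight is larger by one. *)
rewrite kE /weight [leqLHS](bigD1 i) //= [leqRHS](bigD1 i) //= mnmDE mnm1E eqxx.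
rewrite (eq_bigr c) => [|j /andP[_ ji]]; first by lia.
by rewrite mnmDE mnm1E eq_sym (negPf ji) addn0.
Qed.

(** With [T] a largest free set and [c] saturated, each [i] outside [T] has a
[v i] supported in [T] such that [v i + c + U_(i)] is in [U]. Translating [c] by
the sum of all [v i] does not affect freeness for [T], and makes one more factor
['X_i] enough to enter [U] for every [i] outside [T] simultaneously. The shift
of [U] by the result is therefore the set of exponents that involve a variable
outside [T]. *)
Lemma prime_shift_exists U : up_closed U -> ~ U 0%MM ->
  exists b, prime_set (shift U b).
Proof.
move=> upU /max_free_set[T [a [fTa maxT]]].
have [c fTc satc] := saturated_translate upU fTa maxT.
have /fin_all_exists[v vP] : forall i, exists v,
    supported T v /\ (i \notin T -> U (v + (c + U_(i)))%MM).
  move=> i; case: (boolP (i \in T)) => [_|Ti].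
    by exists 0%MM; split=> //; apply: supported0.
  by have [v sv Uv] := unfreeP (satc i Ti); exists v.
exists (\sum_i v i + c)%MM; apply: (@prime_set_coordinates _ T) => u; split.
  move=> Uu; apply: NNPP => nex; apply: (fTc (u + \sum_i v i)%MM); last first.
    by rewrite -addmA.
  move=> i Ti; rewrite mnmDE mnm_sumE big1 ?addn0.
    by apply/eqP/negPn/negP => ui; apply: nex; exists i.
  by move=> j _; apply: (proj1 (vP j)).
move=> [i Ti ui]; apply: up_closed_le ((proj2 (vP i)) Ti) => //.
apply/mnm_lepP => j; rewrite !mnmDE mnm1E mnm_sumE (bigD1 i) //=.
by case: eqP => [<-|_]; lia.
Qed.

End UpClosed.

(** * Ideals *)

Lemma ideal_gen_is_ideal (R : comNzRingType) (A : R -> Prop) :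
  is_ideal (ideal_gen A).
Proof.
split=> [J [] //|g h Ag Ah J idJ AJ|a g Ag J idJ AJ]; case: (idJ) => J0 JD JM.
  by apply: JD; [apply: Ag | apply: Ah].
by apply: JM; apply: Ag.
Qed.

Lemma ideal_add_is_ideal (R : comNzRingType) (I J : R -> Prop) :
  is_ideal I -> is_ideal J -> is_ideal (ideal_add I J).
Proof.
move=> [I0 ID IM] [J0 JD JM]; split.
- by exists 0, 0; split; rewrite ?addr0.
- move=> _ _ [a [b [Ia Jb ->]]] [c [d [Ic Jd ->]]].
  by exists (a + c), (b + d); split; [apply: ID | apply: JD | rewrite addrACA].
move=> r _ [a [b [Ia Jb ->]]].
by exists (r * a), (r * b); split; [apply: IM | apply: JM | rewrite mulrDr].
Qed.

(** * Monomial ideals *)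

Section MonomialIdeals.
Variables (K : fieldType) (n : nat).
Implicit Types (U V : 'X_{1..n} -> Prop) (p q f : {mpoly K[n]}).
Implicit Types (I P : {mpoly K[n]} -> Prop).

Definition mono_ideal U p := forall u, u \in msupp p -> U u.

Lemma mono_idealX U u : mono_ideal U 'X_[u] <-> U u.
Proof.
split=> [|Uu v]; last by rewrite msuppX inE => /eqP->.
by apply; rewrite msuppX mem_head.
Qed.

Lemma mono_ideal_is_ideal U : up_closed U -> is_ideal (mono_ideal U).
Proof.
move=> upU; split=> [u|p q Up Uq u|p q Uq u]; first by rewrite msupp0.
  by move/msuppD_le; rewrite mem_cat => /orP[/Up|/Uq].
move/msuppM_le/allpairsP => [[v w] /= [_ /Uq Uw ->]].
by rewrite addmC; apply: upU.
Qed.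

Lemma mono_ideal_min U I : is_ideal I ->
  (forall u, U u -> I 'X_[u]) -> forall p, mono_ideal U p -> I p.
Proof.
move=> [I0 ID IM] UI p Up; rewrite (mpolyE p) big_seq.
by apply: big_ind => // u /Up Uu; rewrite -mul_mpolyC; apply/IM/UI.
Qed.

Lemma monomial_idealE I : is_monomial_ideal I ->
  exists2 U, up_closed U & set_eq I (mono_ideal U).
Proof.
move=> [S IE]; pose U u := exists2 s, S s & (s <= u)%MM.
have upU : up_closed U.
  by move=> u v [s Ss su]; exists s => //; apply: lepm_trans su (lem_addr _ _).
exists U => // p; split=> [/IE Ip|Up].
  apply: Ip; first exact: mono_ideal_is_ideal.
  by move=> _ [s Ss ->]; apply/mono_idealX; exists s => //; apply: lepm_refl.
apply/IE => J idJ SJ; apply: mono_ideal_min Up => // u [s Ss /submK <-].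
by rewrite mpolyXD; case: (idJ) => _ _; apply; apply: SJ; exists s.
Qed.

Lemma colon_monomial U a :
  set_eq (colon (mono_ideal U) 'X_[a]) (mono_ideal (shift U a)).
Proof.
move=> p; have suppE := perm_mem (msuppMX p a).
split=> [Ip u pu|Vp u]; last first.
  by rewrite suppE => /mapP[v /Vp Vv ->]; rewrite addmC.
by rewrite /shift addmC; apply: Ip; rewrite suppE; apply: map_f.
Qed.

Lemma split_supp V p : exists p1 p2,
  [/\ p = p1 + p2, mono_ideal V p1 & mono_ideal (fun u => ~ V u) p2].
Proof.
elim/mpolyind: p => [|c u p _ _ [p1 [p2 [-> Vp1 Vp2]]]].
  by exists 0, 0; split=> [|u|u]; rewrite ?addr0 ?msupp0.
have suppZ W q : W u -> mono_ideal W q -> mono_ideal W (c *: 'X_[u] + q).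
  move=> Wu Wq v /msuppD_le; rewrite mem_cat => /orP[/msuppZ_le|/Wq //].
  by rewrite msuppX inE => /eqP->.
case: (classic (V u)) => Vu.
  by exists (c *: 'X_[u] + p1), p2; split; rewrite ?addrA //; apply: suppZ.
exists p1, (c *: 'X_[u] + p2); split; rewrite 1?addrCA //.
by apply: (suppZ (fun v => ~ V v)).
Qed.

(** Discarding from [p] and [q] the terms with exponent in [V] does not change
whether [p], [q] or [p * q] is in the ideal. If nonzero polynomials [p2] and
[q2] remain, then the exponent of the leading monomial of [p2 * q2] is a sum of
two exponents outside [V], hence is outside [V]. *)
Lemma mono_ideal_prime V :
  up_closed V -> prime_set V -> is_prime (mono_ideal V).
Proof.
move=> upV [V0 VD]; have idV := mono_ideal_is_ideal upV.
split=> // [|p q Vpq]; first by rewrite /is_proper -mpolyX0 => /mono_idealX.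
have [p1 [p2 [pE Vp1 Vp2]]] := split_supp V p.
have [q1 [q2 [qE Vq1 Vq2]]] := split_supp V q.
have [p20|p2N0] := eqVneq p2 0; first by left; rewrite pE p20 addr0.
have [q20|q2N0] := eqVneq q2 0; first by right; rewrite qE q20 addr0.
have Vpq2 : mono_ideal V (p2 * q2).
  (* The corrections are multiples of [p1] and [q1], which are in the ideal. *)
  have ->: p2 * q2 = p * q + (- q * p1 + - p2 * q1) by rewrite pE qE; ring.
  by case: idV => _ addV mulV; apply: (addV) => //; apply: addV; apply: mulV.
have := Vpq2 _ (mlead_supp (mulf_neq0 p2N0 q2N0)).
rewrite mleadM // => /VD[]; first by case/(Vp2 _ (mlead_supp p2N0)).
by case/(Vq2 _ (mlead_supp q2N0)).
Qed.

Lemma is_prime_eq P Q : set_eq P Q -> is_prime P -> is_prime Q.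
Proof.
move=> PQ [[P0 PD PM] P1 Pprime]; split.
- split; first exact/PQ; first by move=> g h /PQ Pg /PQ Ph; apply/PQ/PD.
  by move=> g h /PQ Ph; apply/PQ/PM.
- by move/PQ.
- by move=> g h /PQ/Pprime[] ?; [left|right]; apply/PQ.
Qed.

(** The associated prime [P] need not be known to be a monomial ideal: only its
monomials are used, and they form a prime set. *)
Lemma monomial_witness U P f : up_closed U -> is_prime P ->
    set_eq (colon (mono_ideal U) f) P ->
  exists2 a, a \in msupp f & prime_set (shift U a).
Proof.
move=> upU [_ P1 PM] fP; pose V u := P 'X_[u].
have VE u : V u <-> forall a, a \in msupp f -> U (u + a)%MM.
  have suppE := perm_mem (msuppMX f u).
  split=> [/fP Uf a fa|Uf]; first by apply: Uf; rewrite mulrC suppE; apply: map_f.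
  by apply/fP => b; rewrite mulrC suppE => /mapP[a /Uf ? ->].
have primeV : prime_set V.
  by split=> [|u v]; rewrite /V ?mpolyX0 ?mpolyXD //; apply: PM.
have [|u Uf|a fa Va] :=
    prime_set_inter (r := msupp f) (W := fun a => shift U a) primeV.
- by move=> a; apply: up_closed_shift.
- exact/VE.
have shiftE u : shift U a u <-> V u by split=> [/Va //|/VE]; apply.
case: primeV => V0 VD; exists a => //.
split=> [/shiftE //|u v /shiftE/VD[] ?]; first by left; apply/shiftE.
by right; apply/shiftE.
Qed.

Lemma vdegree_monomial U d : up_closed U ->
  vdegree (mono_ideal U) d <-> exists2 a, mdeg a = d & prime_set (shift U a).
Proof.
move=> upU; split=> [[f [P [/dhomogP homf [primeP _] fP]]]|[a ad primea]].
  by have [a /homf] := monomial_witness upU primeP fP; exists a.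
have colonE := @colon_monomial U a.
exists 'X_[a], (colon (mono_ideal U) 'X_[a]); split=> //.
  by rewrite dhomogX; apply/eqP.
split; last by exists 'X_[a].
apply: is_prime_eq (mono_ideal_prime (up_closed_shift upU) primea).
by move=> g; apply: iff_sym.
Qed.

Lemma vdegree_eq I J d : set_eq I J -> vdegree I d -> vdegree J d.
Proof.
move=> IJ [f [P [homf [primeP [g Pg]] fP]]]; exists f, P; split=> //.
  by split=> //; exists g => h; apply: iff_trans (Pg h) (IJ _).
by move=> h; apply: iff_trans (fP h); apply: iff_sym; apply: IJ.
Qed.

Lemma is_least_vdegree I U d : up_closed U -> set_eq I (mono_ideal U) ->
  is_least (fun d => exists2 a, mdeg a = d & prime_set (shift U a)) d ->
  is_least (vdegree I) d.
Proof.
move=> upU IU [ex_d min_d]; split=> [|e].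
  by apply: (@vdegree_eq (mono_ideal U)) => [p|];
    [apply: iff_sym | apply/vdegree_monomial].
by move/(vdegree_eq IU)/vdegree_monomial => /(_ upU)/min_d.
Qed.

(** Since a v-number is an [epsilon], it has its meaning only where a least
degree exists; properness of [I] provides it. *)
Lemma vnumber_witness I U : up_closed U -> set_eq I (mono_ideal U) ->
    is_proper I ->
  exists a, [/\ mdeg a = vnumber I, prime_set (shift U a) &
    forall b, prime_set (shift U b) -> (vnumber I <= mdeg b)%N].
Proof.
move=> upU IU I1.
have [|d least_d] := @least_exists
    (fun d => exists2 a, mdeg a = d & prime_set (shift U a)).
  have [|a primea] := prime_shift_exists upU; last by exists (mdeg a), a.
  by move/mono_idealX/IU; rewrite mpolyX0.
rewrite (vnumberE (is_least_vdegree upU IU least_d)).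
case: least_d => [[a ad primea] min_d]; exists a; split=> // b primeb.
by apply: min_d; exists b.
Qed.

End MonomialIdeals.

Lemma ideal_ext_mono (K : fieldType) (k l : nat) (lq : k.-tuple {mpoly K[l]})
    (W : 'X_{1..l} -> Prop) (U : 'X_{1..k} -> Prop) (I : {mpoly K[k]} -> Prop) :
    up_closed W -> set_eq I (mono_ideal U) ->
    (forall u, U u -> mono_ideal W (comp_mpoly lq 'X_[u])) ->
  forall p, ideal_ext (comp_mpoly lq) I p -> mono_ideal W p.
Proof.
move=> upW IU lqW p; apply; first exact: mono_ideal_is_ideal.
move=> _ [q /IU Uq ->]; rewrite (mpolyE q) linear_sum big_seq.
have [W0 WD WM] := mono_ideal_is_ideal K upW.
apply: big_ind => // u /Uq Uu.
by rewrite linearZ /= -mul_mpolyC; apply/WM/lqW.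
Qed.

(** * Disjoint sets of variables *)

Section Join.
Variables n m : nat.
Implicit Types (u v w : 'X_{1..n + m}).

Definition xpart u : 'X_{1..n} := [multinom u (lshift m i) | i < n].
Definition ypart u : 'X_{1..m} := [multinom u (rshift n i) | i < m].

Definition joinm (a : 'X_{1..n}) (b : 'X_{1..m}) : 'X_{1..n + m} :=
  [multinom match split i with inl j => a j | inr j => b j end | i < n + m].

Lemma joinm_lshift a b i : joinm a b (lshift m i) = a i.
Proof.
by rewrite mnmE; case: split_ordP => j /eqP; rewrite ?eq_shift // => /eqP->.
Qed.

Lemma joinm_rshift a b i : joinm a b (rshift n i) = b i.
Proof.
by rewrite mnmE; case: split_ordP => j /eqP; rewrite ?eq_shift // => /eqP->.
Qed.

Lemma xpart_joinm a b : xpart (joinm a b) = a.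
Proof. by apply/mnmP => i; rewrite mnmE joinm_lshift. Qed.

Lemma ypart_joinm a b : ypart (joinm a b) = b.
Proof. by apply/mnmP => i; rewrite mnmE joinm_rshift. Qed.

Lemma xpartD u v : xpart (u + v)%MM = (xpart u + xpart v)%MM.
Proof. by apply/mnmP => i; rewrite !(mnmE, mnmDE). Qed.

Lemma ypartD u v : ypart (u + v)%MM = (ypart u + ypart v)%MM.
Proof. by apply/mnmP => i; rewrite !(mnmE, mnmDE). Qed.

Lemma joinmK u : joinm (xpart u) (ypart u) = u.
Proof.
apply/mnmP => i; case: (split_ordP i) => j ->.
  by rewrite joinm_lshift mnmE.
by rewrite joinm_rshift mnmE.
Qed.

Lemma joinm_split a b : joinm a b = (joinm a 0 + joinm 0 b)%MM.
Proof.
by rewrite -[RHS]joinmK xpartD ypartD !xpart_joinm !ypart_joinm addm0 add0m.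
Qed.

Lemma mdeg_parts u : mdeg u = (mdeg (xpart u) + mdeg (ypart u))%N.
Proof.
by rewrite !mdegE big_split_ord; congr (_ + _)%N; apply: eq_bigr => i _;
  rewrite mnmE.
Qed.

Lemma incl_xX (K : fieldType) a :
  incl_x m 'X_[a] = 'X_[joinm a 0] :> {mpoly K[n + m]}.
Proof.
rewrite /incl_x comp_mpolyX [RHS]mpolyXE_id big_split_ord /=.
rewrite [X in _ * X]big1 ?mulr1 => [|i _]; last by rewrite joinm_rshift mnm0E.
by apply: eq_bigr => i _; rewrite tnth_mktuple joinm_lshift.
Qed.

Lemma incl_yX (K : fieldType) b :
  incl_y n 'X_[b] = 'X_[joinm 0 b] :> {mpoly K[n + m]}.
Proof.
rewrite /incl_y comp_mpolyX [RHS]mpolyXE_id big_split_ord /=.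
rewrite [X in X * _]big1 ?mul1r => [|i _]; last by rewrite joinm_lshift mnm0E.
by apply: eq_bigr => i _; rewrite tnth_mktuple joinm_rshift.
Qed.

Definition join_set (U1 : 'X_{1..n} -> Prop) (U2 : 'X_{1..m} -> Prop) u :=
  U1 (xpart u) \/ U2 (ypart u).

Lemma up_closed_join U1 U2 :
  up_closed U1 -> up_closed U2 -> up_closed (join_set U1 U2).
Proof.
by move=> up1 up2 u v; rewrite /join_set xpartD ypartD => -[];
  [left; apply: up1 | right; apply: up2].
Qed.

(** From left to right, primality is tested on exponents that involve only one
block of variables; the other block then stays at [w], which lies outside its
set because [w] is outside the join. *)
Lemma prime_shift_join U1 U2 w :
  prime_set (shift (join_set U1 U2) w) <->
  prime_set (shift U1 (xpart w)) /\ prime_set (shift U2 (ypart w)).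
Proof.
rewrite /prime_set /shift /join_set; split; last first.
  move=> [[N1 D1] [N2 D2]]; split=> [|u v].
    by move: N1 N2; rewrite !add0m => ? ? [].
  by rewrite !xpartD !ypartD => -[/D1|/D2] []; auto.
move=> [N D]; move: N; rewrite !add0m => N.
have [N1 N2] : ~ U1 (xpart w) /\ ~ U2 (ypart w) by split; auto.
split; split=> // a b Uab.
  have := D (joinm a 0) (joinm b 0).
  rewrite !xpartD !ypartD !xpart_joinm !ypart_joinm !add0m.
  by case; auto => -[]; auto.
have := D (joinm 0 a) (joinm 0 b).
rewrite !xpartD !ypartD !xpart_joinm !ypart_joinm !add0m.
by case; auto => -[]; auto.
Qed.

Lemma sum_ext_mono (K : fieldType) (I1 : {mpoly K[n]} -> Prop)
    (I2 : {mpoly K[m]} -> Prop) U1 U2 :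
    up_closed U1 -> up_closed U2 ->
    set_eq I1 (mono_ideal U1) -> set_eq I2 (mono_ideal U2) ->
  set_eq (ideal_add (ideal_ext (@incl_x K n m) I1)
                    (ideal_ext (@incl_y K n m) I2))
         (mono_ideal (join_set U1 U2)).
Proof.
move=> up1 up2 IU1 IU2 p; have upJ := up_closed_join up1 up2.
split=> [[a [b [Ia Ib ->]]]|].
  have [_ WD _] := mono_ideal_is_ideal K upJ; apply: WD.
    apply: (ideal_ext_mono upJ IU1 _ Ia) => u Uu.
    rewrite -/(incl_x m 'X_[u]) incl_xX.
    by apply/mono_idealX; left; rewrite xpart_joinm.
  apply: (ideal_ext_mono upJ IU2 _ Ib) => u Uu.
  rewrite -/(incl_y n 'X_[u]) incl_yX.
  by apply/mono_idealX; right; rewrite ypart_joinm.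
have idx := @ideal_gen_is_ideal _ (fun q => exists2 p, I1 p & q = @incl_x K n m p).
have idy := @ideal_gen_is_ideal _ (fun q => exists2 p, I2 p & q = @incl_y K n m p).
apply: mono_ideal_min; first exact: ideal_add_is_ideal.
move=> u; rewrite -[u in 'X_[u]]joinmK joinm_split mpolyXD -incl_xX -incl_yX.
case: idx => x0 _ xM; case: idy => y0 _ yM.
case=> Uu.
  exists (incl_x m 'X_[xpart u] * incl_y n 'X_[ypart u]), 0.
  split; rewrite ?addr0 //.
  rewrite mulrC; apply: xM => J _; apply; exists 'X_[xpart u] => //.
  exact/IU1/mono_idealX.
exists 0, (incl_x m 'X_[xpart u] * incl_y n 'X_[ypart u]).
split; rewrite ?add0r //.
apply: yM => J _; apply; exists 'X_[ypart u] => //.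
exact/IU2/mono_idealX.
Qed.

End Join.

Theorem proposition3p9 (K : fieldType) (n m : nat)
    (I1 : {mpoly K[n]} -> Prop) (I2 : {mpoly K[m]} -> Prop)
    (hI1 : is_monomial_ideal I1) (hI1p : is_proper I1)
    (hI2 : is_monomial_ideal I2) (hI2p : is_proper I2) :
  vnumber (ideal_add (ideal_ext (@incl_x K n m) I1)
                     (ideal_ext (@incl_y K n m) I2))
  = (vnumber I1 + vnumber I2)%N.
Proof.
have [U1 up1 IU1] := monomial_idealE hI1.
have [U2 up2 IU2] := monomial_idealE hI2.
have [a [adeg primea mina]] := vnumber_witness up1 IU1 hI1p.
have [b [bdeg primeb minb]] := vnumber_witness up2 IU2 hI2p.
apply/vnumberE/(is_least_vdegree (up_closed_join up1 up2)).
  exact: sum_ext_mono.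
split=> [|_ [w <- /prime_shift_join[prime1 prime2]]].
  exists (joinm a b).
    by rewrite mdeg_parts xpart_joinm ypart_joinm adeg bdeg.
  by apply/prime_shift_join; rewrite xpart_joinm ypart_joinm.
by rewrite mdeg_parts leq_add ?mina ?minb.
Qed.
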